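(* Let $G$ be a finite commutative group with $|G|=q$, and let $A_1,A_2\subset G$ be standard sets. Then \[ \lambda(A_1\cap A_2)\le q\,\lambda(A_1)\lambda(A_2),\qquad \lambda^+(A_1\cap A_2)\le q\,\lambda^+(A_1)\lambda^+(A_2), \] \[ \lambda^-(A_1\cap A_2)\le q\,\lambda^-(A_1)\lambda^+(A_2),\qquad \lambda^\pm(A_1\cap A_2)\le q\,\lambda^\pm(A_1)\lambda^+(A_2). \]
   Context: $G$ is written additively. A set $A\subset G$ is a standard set if $A=-A$ and $0\in A$. A character of $G$ is a homomorphism $\gamma:G\to\{z\in\mathbb C:|z|=1\}$; $\hat G$ is the group of characters and $\mathbf 1$ the principal character. For $f:G\to\mathbb R$, $\hat f(\gamma)=\sum_{x\in G}\gamma(x)f(x)$. Classes of functions $f:G\to\mathbb R$ not identically zero: $\mathcal S(A)$: $f=0$ on $G\setminus A$; $\mathcal S^-(A)$: $f\le0$ on $G\setminus A$; $\mathcal S^+(A)$: $f=0$ on $G\setminus A$, $f\ge0$ on $A$; $\mathcal S^\pm(A)$: $f\le0$ on $G\setminus A$, $f\ge0$ on $A$. $\lambda(A)=\min\{f(0)/\hat f(\mathbf 1): f\in\mathcal S(A),\ \hat f\ge0\text{ on }\hat G\}$, and $\lambda^-,\lambda^+,\lambda^\pm$ are defined likewise with $\mathcal S^-,\mathcal S^+,\mathcal S^\pm$. *)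

(* Defs.v *)
From HB Require Import structures.
From mathcomp Require Import all_boot all_order all_algebra.
From mathcomp Require Import classical_sets reals complex.

Set Implicit Arguments.
Unset Strict Implicit.
Unset Printing Implicit Defensive.

Import Order.TTheory GRing.Theory Num.Theory.

Local Open Scope classical_set_scope.
Local Open Scope ring_scope.
Local Open Scope complex_scope.

Definition standard (G : finZmodType) (A : {set G}) : Prop :=
  A = (-%R @: A)%SET /\ 0 \in A.

Record character (R : realType) (G : finZmodType) := Character {
  char_fun :> G -> R[i];
  char_morph : {morph char_fun : x y / x + y >-> x * y};
  char_norm : forall x, `|char_fun x| = 1
}.

Lemma principal_morph (R : realType) (G : finZmodType) :
  {morph (fun=> 1 : R[i]) : x y / x + y : G >-> x * y}.
Proof. by move=> x y; rewrite mulr1. Qed.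

Lemma principal_norm (R : realType) (G : finZmodType) (x : G) :
  `|(fun=> 1 : R[i]) x| = 1.
Proof. exact: normr1. Qed.

Definition principal (R : realType) (G : finZmodType) : character R G :=
  Character (@principal_morph R G) (@principal_norm R G).

Section ExtremalProblems.
Variables (R : realType) (G : finZmodType).
Implicit Types (f : G -> R) (A : {set G}).

Definition fourier f (gamma : character R G) : R[i] :=
  \sum_(x : G) gamma x * (f x)%:C.

Definition nonzero f : Prop := exists x, f x != 0.

Definition class_S A : set (G -> R) :=
  [set f | nonzero f /\ forall x, x \notin A -> f x = 0].

Definition class_Sminus A : set (G -> R) :=
  [set f | nonzero f /\ forall x, x \notin A -> f x <= 0].

Definition class_Splus A : set (G -> R) :=
  [set f | [/\ nonzero f, forall x, x \notin A -> f x = 0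
                        & forall x, x \in A -> 0 <= f x]].

Definition class_Spm A : set (G -> R) :=
  [set f | [/\ nonzero f, forall x, x \notin A -> f x <= 0
                        & forall x, x \in A -> 0 <= f x]].

(* The order of R[i] makes [0 <= z] mean that z is real and nonnegative.
   Functions with [fourier f principal = 0] are left out: a nonzero f with
   nonnegative transform has f 0 > 0, so their ratio is +oo and is irrelevant
   to the minimum, whereas division by 0 in R[i] would yield 0. *)
Definition ratios (S : set (G -> R)) : set R :=
  [set r | exists f, [/\ S f,
    forall gamma, 0 <= fourier f gamma,
    fourier f (principal R G) != 0
    & r%:C = (f 0)%:C / fourier f (principal R G)]].

(* The least element of X, or 0 when there is none. For the four sets below it
   exists when A is standard: normalising the sum of f to 1, the competitors
   with f 0 <= 1 (the indicator of 0 is one) form a compact set. *)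
Definition min_of (X : set R) : R := xget 0 (X `&` lbound X).

Definition lambda A : R := min_of (ratios (class_S A)).
Definition lambda_minus A : R := min_of (ratios (class_Sminus A)).
Definition lambda_plus A : R := min_of (ratios (class_Splus A)).
Definition lambda_pm A : R := min_of (ratios (class_Spm A)).

End ExtremalProblems.

(* Main.v *)
(* The product of extremal functions f1 for A1 and f2 for A2 is a competitor for
   A1 :&: A2: its transform is 1/q times the convolution of the two nonnegative
   transforms, hence nonnegative, and at the principal character the convolution
   is at least the single term f1^(1) f2^(1), which is the inequality. Sign
   conditions survive the product because a function in S^+ is nonnegative
   everywhere.
   The convolution formula needs q = #|G| characters with dual orthogonality.
   They come from simultaneously diagonalising the translations of C^G, which
   commute and have finite order: the joint eigenvectors are multiples of
   characters, and row orthogonality of the square character table gives column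
   orthogonality.
   Since [min_of] is 0 when there is no least element, one must also show that
   the minima are attained: inversion gives |f x| <= f 0, so compactness applies. *)

Require Import Defs.
From HB Require Import structures.
From mathcomp Require Import all_boot all_order all_algebra.
From mathcomp Require Import fingroup cyclic separable cyclotomic.
From mathcomp Require Import boolp classical_sets reals complex.
From mathcomp Require Import topology normedtype derive.
From mathcomp Require Import ring.

Set Implicit Arguments.
Unset Strict Implicit.
Unset Printing Implicit Defensive.

Import Order.TTheory GRing.Theory Num.Theory.
Import numFieldNormedType.Exports.
Local Open Scope classical_set_scope.
Local Open Scope ring_scope.
Local Open Scope complex_scope.

(** * Elements and matrices of finite order *)

Lemma mulrn_card_group (G : finZmodType) (x : G) : x *+ #|G| = 0.
Proof. by rewrite -FinRing.zmodXgE -cardsT expg_cardG ?inE. Qed.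

(** The minimal polynomial divides ['X^m - 1], which has simple roots because [m] is invertible in
    [F]. *)
Lemma diagonalizable_finite_order (F : closedFieldType) n (A : 'M[F]_n.+1) m :
  m%:R != 0 :> F -> A ^+ m = 1 -> diagonalizable A.
Proof.
move=> m0 Am; apply/diagonalizableP.
have mgt0 : (0 < m)%N by case: m m0 {Am}; rewrite ?eqxx.
have [rs Ers] := closed_field_poly_normal ('X^m - 1 : {poly F}).
have lc1 : lead_coef ('X^m - 1 : {poly F}) = 1.
  by apply/eqP; rewrite -[_ == _]/(_ \is monic) monicXnsubC.
rewrite lc1 scale1r in Ers.
exists rs; first by rewrite -separable_prod_XsubC -Ers separable_Xn_sub_1.
rewrite -Ers; apply: mxminpoly_min.
by rewrite rmorphB rmorphXn rmorph1 /= horner_mx_X Am subrr.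
Qed.

(** * Characters and dual orthogonality *)

Section Characters.
Variables (R : realType) (G : finZmodType).
Implicit Types (gamma : character R G) (f g : G -> R) (A : {set G}).

Lemma char0 gamma : gamma 0 = 1.
Proof.
have g0 : gamma 0 != 0 by rewrite -normr_gt0 char_norm.
by apply: (mulfI g0); rewrite -char_morph addr0 mulr1.
Qed.

Lemma char_opp_morph gamma :
  {morph (fun x => gamma (- x)) : x y / x + y >-> x * y}.
Proof. by move=> x y; rewrite opprD char_morph. Qed.

Definition char_opp gamma : character R G :=
  Character (char_opp_morph gamma) (fun x => char_norm gamma (- x)).

Lemma char_mul_morph gamma1 gamma2 :
  {morph (fun x => gamma1 x * gamma2 x) : x y / x + y >-> x * y}.
Proof. by move=> x y; rewrite !char_morph mulrACA. Qed.

Lemma char_mul_norm gamma1 gamma2 x : `|gamma1 x * gamma2 x| = 1.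
Proof. by rewrite normrM !char_norm mulr1. Qed.

Definition char_mul gamma1 gamma2 : character R G :=
  Character (@char_mul_morph gamma1 gamma2) (@char_mul_norm gamma1 gamma2).

Lemma sum_char gamma : (exists x, gamma x != 1) -> \sum_x gamma x = 0.
Proof.
move=> [a ga]; apply/eqP; have : gamma a * \sum_x gamma x == \sum_x gamma x.
  rewrite [X in _ == X](reindex_inj (addrI a)) mulr_sumr /=.
  by apply/eqP/eq_bigr => x _; rewrite char_morph.
rewrite -subr_eq0 -[X in _ - X]mul1r -mulrBl mulf_eq0 subr_eq0.
by rewrite (negbTE ga).
Qed.

(* The joint eigenvectors of the translations are multiples of characters. *)
Lemma joint_eigenfunction (u : G -> R[i]) (d : G -> R[i]) :
  (forall x y, u (x + y) = d y * u x) -> u 0 != 0 ->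
  exists gamma : character R G, forall x, u x = u 0 * gamma x.
Proof.
move=> ud u0.
have uE x : u x = u 0 * d x by rewrite mulrC -ud add0r.
have dM : {morph d : x y / x + y >-> x * y}.
  by move=> x y; apply: (mulfI u0); rewrite -uE ud (uE x) [LHS]mulrC mulrA.
have d0 : d 0 = 1 by apply: (mulfI u0); rewrite -uE mulr1.
have dX x m : d (x *+ m) = d x ^+ m.
  by elim: m => [|m IH]; rewrite ?d0// mulrS exprS dM IH.
(* Since [x *+ #|G| = 0], the value [d x] is a root of unity. *)
have dN x : `|d x| = 1.
  apply/eqP; rewrite -(@pexpr_eq1 _ _ #|G|) ?normr_ge0 -?normrX//; last first.
    by apply/card_gt0P; exists 0.
  by rewrite -dX mulrn_card_group d0 normr1.
by exists (Character dM dN).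
Qed.

(** Dual orthogonality stands in for the claim that [chi] lists the whole dual group; later
    arguments use the family only through this identity. *)
Definition complete_family (chi : 'I_#|G| -> character R G) : Prop :=
  forall x, \sum_i chi i x = #|G|%:R * (x == 0)%:R.

Lemma complete_family_exists :
  exists chi : 'I_#|G| -> character R G, complete_family chi.
Proof.
have cG0 : #|G|%:R != 0 :> R[i].
  by rewrite pnatr_eq0 -lt0n; apply/card_gt0P; exists 0.
have [n En] : exists n, #|G| = n.+1.
  by case E: #|G| cG0 => [|n]; [rewrite eqxx|exists n].
pose e (i : 'I_n.+1) : G := enum_val (cast_ord (esym En) i).
pose r (x : G) : 'I_n.+1 := cast_ord En (enum_rank x).
have eK : cancel e r by move=> i; rewrite /r/e enum_valK cast_ordKV.
have rK : cancel r e by move=> i; rewrite /r/e cast_ordK enum_rankK.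
have ebij : bijective e by exists r.
have sumE (F : G -> R[i]) : \sum_i F (e i) = \sum_x F x.
  by rewrite [RHS](reindex e) //; exact: onW_bij.
(* Row vectors are functions on [G]; multiplying on the right by [T y] translates the argument by
   [y]. *)
pose T y : 'M[R[i]]_n.+1 := \matrix_(i, j) (e i == e j + y)%:R.
have mulT (u : 'M[R[i]]_n.+1) y i x : (u *m T y) i (r x) = u i (r (x + y)).
  rewrite !mxE (bigD1 (r (x + y))) //= !mxE !rK eqxx mulr1 big1 ?addr0 // => k kr.
  rewrite mxE rK; case: eqP => [E|]; last by rewrite mulr0.
  by rewrite -E eK eqxx in kr.
have T0 : T 0 = 1.
  by apply/matrixP => i j; rewrite !mxE addr0 (can_eq eK).
have TD y z : T y * T z = T (y + z).
  by apply/matrixP => i j; rewrite -[j]eK mulT !mxE !rK -addrA [z + y]addrC.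
have TX y m : T y ^+ m = T (y *+ m).
  by elim: m => [|m IH]; rewrite ?T0// exprS mulrS IH TD.
have [P Pu /allP PD] : codiagonalizable [seq T y | y <- enum G].
  apply/codiagonalizableP; split.
    move=> _ _ /mapP[y _ ->] /mapP[z _ ->].
    by rewrite /comm_mx -![_ *m _]/(_ * _) !TD addrC.
  move=> _ /mapP[y _ ->]; apply: (diagonalizable_finite_order cG0).
  by rewrite TX mulrn_card_group T0.
have PE i : exists d : G -> R[i], forall x y, P i (r (x + y)) = d y * P i (r x).
  have D y : exists d : R[i], forall x, P i (r (x + y)) = d * P i (r x).
    have := PD (T y); rewrite map_f ?mem_enum // => /(_ isT)/diagonalizable_forPex.
    case=> d /(simmxP Pu) /matrixP Pd; exists (d 0 i) => x.
    by rewrite -mulT Pd mul_diag_mx mxE.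
  (* [xget] picks one eigenvalue for each [y]; [D y] rules out the default 0. *)
  by exists (fun y => xget 0 [set d | forall x, P i (r (x + y)) = d * P i (r x)]%classic)
     => x y; case: xgetP => [z _ /(_ x)//|]; have [d dP] := D y => /(_ d).
(* An eigenfunction vanishing at 0 vanishes on all its translates, so row [i] of the invertible [P]
   would be zero. *)
have P0 i : P i (r 0) != 0.
  apply/eqP => Pi0; have [d dP] := PE i.
  suff rP0 : row i P = 0.
    move: Pu; rewrite -row_free_unit => /row_freeP[B PB].
    have : (row i P *m B) 0 i = 1 by rewrite -row_mul PB !mxE eqxx.
    by rewrite rP0 mul0mx mxE => /esym/eqP; rewrite oner_eq0.
  by apply/rowP => j; rewrite !mxE -[j]eK -[e j]add0r dP Pi0 mulr0.
have /fin_all_exists[chi chiP] i :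
    exists gamma : character R G, forall x, P i (r x) = P i (r 0) * gamma x.
  by have [d dP] := PE i; exact: (joint_eigenfunction dP).
pose U : 'M[R[i]]_n.+1 := \matrix_(i, j) chi i (e j).
pose V : 'M[R[i]]_n.+1 := \matrix_(j, i) chi i (- e j).
(* [P] is the character table [U] with its rows rescaled, so [U] inherits invertibility. *)
have PU : P = diag_mx (\row_i P i (r 0)) *m U.
  by apply/matrixP => i j; rewrite mul_diag_mx !mxE -[j in LHS]eK chiP.
have Uu : U \in unitmx by move: Pu; rewrite PU unitmx_mul => /andP[].
have UV : U *m V = #|G|%:R%:M.
  apply/matrixP => i k; rewrite !mxE.
  under eq_bigr do rewrite !mxE.
  rewrite (sumE (fun x => chi i x * chi k (- x))).
  have [<-|ik] := eqVneq i k.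
    under eq_bigr do rewrite -char_morph subrr char0.
    by rewrite sumr_const.
  rewrite mulr0n; apply: (@sum_char (char_mul (chi i) (char_opp (chi k)))) => /=.
  (* Distinct rows of an invertible matrix differ, so [chi i] times the inverse of [chi k] is a
     nontrivial character and sums to 0. *)
  have [x xP] : exists x, chi i x != chi k x.
    apply/existsP; rewrite -negb_forall; apply: contra ik => /forallP ik.
    have rowE : delta_mx 0 i *m U = delta_mx 0 k *m U :> 'rV_n.+1.
      by rewrite -!rowE; apply/rowP => j; rewrite !mxE; apply/eqP.
    move/(can_inj (mulmxK Uu))/rowP/(_ i)/eqP: rowE.
    by rewrite !mxE !eqxx /=; case: (i =P k) => // _; rewrite oner_eq0.
  exists x; apply: contra xP => /eqP E; apply/eqP.
  have := congr1 (fun z => z * chi k x) E.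
  by rewrite /= -mulrA -char_morph addNr char0 mulr1 mul1r.
(* A one-sided inverse of a square matrix is two-sided: row orthogonality becomes column
   orthogonality. *)
have VU : V *m U = #|G|%:R%:M.
  have /mulmx1C : U *m (#|G|%:R^-1 *: V) = 1%:M.
    by rewrite -scalemxAr UV scale_scalar_mx mulVf.
  rewrite -scalemxAl => /(congr1 (fun M => #|G|%:R *: M)).
  by rewrite /= scalerA mulfV // scale1r scale_scalar_mx mulr1.
exists (fun i => chi (cast_ord En i)) => x.
rewrite (reindex (cast_ord (esym En))) /=; last first.
  by apply: onW_bij; exists (cast_ord En); [exact: cast_ordKV|exact: cast_ordK].
have := congr1 (fun M : 'M_n.+1 => M (r 0) (r x)) VU.
rewrite !mxE (can_eq rK) eq_sym mulr_natr => <-.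
by apply: eq_bigr => i _; rewrite !mxE !rK oppr0 char0 mul1r cast_ordKV.
Qed.

(** * Fourier inversion and products *)

Lemma fourier_inv (chi : 'I_#|G| -> character R G) f x :
  complete_family chi ->
  #|G|%:R * (f x)%:C = \sum_i fourier f (chi i) * chi i (- x).
Proof.
move=> chiP; transitivity (\sum_y (f y)%:C * \sum_i chi i (y - x)).
  under eq_bigr do rewrite chiP subr_eq0.
  rewrite (bigD1 x) //= big1 => [|y /negbTE ->]; last by rewrite !mulr0.
  by rewrite eqxx mulr1 addr0 mulrC.
under eq_bigr do rewrite mulr_sumr; rewrite exchange_big /=.
apply: eq_bigr => i _; rewrite mulr_suml; apply: eq_bigr => y _.
by rewrite char_morph mulrA [_ * chi i y]mulrC.
Qed.

Lemma fourier_principal f : fourier f (principal R G) = (\sum_x f x)%:C.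
Proof. by rewrite rmorph_sum; apply: eq_bigr => x _; rewrite mul1r. Qed.

Lemma card_group_gt0 : 0 < #|G|%:R :> R[i].
Proof. by rewrite ltr0n; apply/card_gt0P; exists 0. Qed.

(** By inversion [f 0] is, up to the factor [#|G|], the sum of the nonnegative coefficients, and
    [f x] is the same sum with unimodular weights. *)
Lemma fourier_ge0_norm_le f :
  (forall gamma, 0 <= fourier f gamma) -> forall x, `|f x| <= f 0.
Proof.
move=> f0 x; have [chi chiP] := complete_family_exists.
have inv y := fourier_inv f y chiP.
rewrite -lecR -(ler_pM2l card_group_gt0) inv.
have -> : `|f x|%:C = `|(f x)%:C| by rewrite normc_def /= expr0n addr0 sqrtr_sqr.
rewrite -[X in X * _]normr_nat -normrM inv.
apply: le_trans (ler_norm_sum _ _ _) _; apply: ler_sum => i _.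
by rewrite normrM char_norm oppr0 char0 !mulr1 ger0_norm.
Qed.

Lemma fourier_ge0_gt0 f : nonzero f ->
  (forall gamma, 0 <= fourier f gamma) -> 0 < f 0.
Proof.
move=> [x fx] /fourier_ge0_norm_le/(_ x); apply: lt_le_trans.
by rewrite normr_gt0.
Qed.

(** Only [f] is expanded by inversion; the factor [chi i (- x)] this brings joins [gamma] in the
    transform of [g]. *)
Lemma fourierM (chi : 'I_#|G| -> character R G) f g gamma :
  complete_family chi ->
  #|G|%:R * fourier (f \* g) gamma =
  \sum_i fourier f (chi i) * fourier g (char_mul gamma (char_opp (chi i))).
Proof.
move=> chiP; under [RHS]eq_bigr do rewrite mulr_sumr.
rewrite exchange_big /= mulr_sumr; apply: eq_bigr => x _.
rewrite rmorphM /=.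
have -> : #|G|%:R * (gamma x * ((f x)%:C * (g x)%:C)) =
    #|G|%:R * (f x)%:C * (gamma x * (g x)%:C) by ring.
rewrite (fourier_inv f x chiP) mulr_suml; apply: eq_bigr => i _ /=.
by ring.
Qed.

Lemma fourierM_ge0 f g :
  (forall gamma, 0 <= fourier f gamma) ->
  (forall gamma, 0 <= fourier g gamma) ->
  forall gamma, 0 <= fourier (f \* g) gamma.
Proof.
move=> f0 g0 gamma; have [chi chiP] := complete_family_exists.
rewrite -(pmulr_rge0 _ card_group_gt0) (fourierM _ _ _ chiP).
by apply: sumr_ge0 => i _; rewrite mulr_ge0.
Qed.

(** Summing the family over all [i] and [x] gives [#|G|], which is nonzero, whereas nontrivial
    characters contribute 0. *)
Lemma principal_in_complete_family (chi : 'I_#|G| -> character R G) :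
  complete_family chi ->
  exists i, forall x, chi i x = 1.
Proof.
move=> chiP; have [i ] : exists i, \sum_x chi i x != 0.
  apply/existsP; rewrite -negb_forall; apply/negP => /forallP h.
  have : \sum_i \sum_x chi i x = 0 by apply: big1 => i _; apply/eqP.
  rewrite exchange_big /=; under eq_bigr do rewrite chiP.
  rewrite -mulr_sumr (bigD1 0) //= big1 => [|y /negbTE -> //].
  by move/eqP; rewrite eqxx addr0 mulr1 (gt_eqF card_group_gt0).
move=> i0; exists i => x; apply/eqP; apply: contraNT i0 => ix.
by rewrite sum_char//; exists x.
Qed.

Lemma sumM_ge f g :
  (forall gamma, 0 <= fourier f gamma) ->
  (forall gamma, 0 <= fourier g gamma) ->
  (\sum_x f x) * (\sum_x g x) <= #|G|%:R * \sum_x (f x * g x).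
Proof.
move=> f0 g0; have [chi chiP] := complete_family_exists.
have [i chii] := principal_in_complete_family chiP.
rewrite -lecR !rmorphM /= rmorph_nat -!fourier_principal (fourierM _ _ _ chiP).
rewrite (bigD1 i) //=.
have -> : fourier f (chi i) = fourier f (principal R G).
  by apply: eq_bigr => x _; rewrite chii.
have -> : fourier g (char_mul (principal R G) (char_opp (chi i))) =
          fourier g (principal R G).
  by apply: eq_bigr => x _ /=; rewrite chii mulr1.
by rewrite lerDl; apply: sumr_ge0 => j _; rewrite mulr_ge0.
Qed.

(** * Ratios of products *)

Lemma ratiosP (S : set (G -> R)) r : ratios S r <->
  exists f, [/\ S f, forall gamma, 0 <= fourier f gamma,
    0 < \sum_x f x & r = f 0 / \sum_x f x].
Proof.
split=> -[f [Sf f0]].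
  rewrite fourier_principal => fp rE; exists f; split=> //.
    have := f0 (principal R G); rewrite fourier_principal ler0c le_eqVlt.
    by case/predU1P => [E|//]; rewrite -E eqxx in fp.
  by apply: complexI; rewrite rE fmorph_div.
move=> fp ->; exists f; split=> //; rewrite fourier_principal.
  by rewrite (fmorph_eq0 (real_complex R)) gt_eqF.
by rewrite fmorph_div.
Qed.

Lemma ratiosM (S1 S2 S : set (G -> R)) r1 r2 :
  S1 `<=` @nonzero R G -> S2 `<=` @nonzero R G ->
  (forall f g, S1 f -> S2 g -> nonzero (f \* g) -> S (f \* g)) ->
  ratios S1 r1 -> ratios S2 r2 ->
  exists2 r, ratios S r & r <= #|G|%:R * r1 * r2.
Proof.
move=> nz1 nz2 S12 /ratiosP[f [Sf f0 fs ->]] /ratiosP[g [Sg g0 gs ->]].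
have f00 := fourier_ge0_gt0 (nz1 _ Sf) f0.
have g00 := fourier_ge0_gt0 (nz2 _ Sg) g0.
have fgE := sumM_ge f0 g0.
have q0 : 0 < #|G|%:R :> R by rewrite ltr0n; apply/card_gt0P; exists 0.
have fgs : 0 < \sum_x (f x * g x).
  by rewrite -(pmulr_rgt0 _ q0) (lt_le_trans _ fgE) // mulr_gt0.
exists (f 0 * g 0 / \sum_x (f x * g x)).
  apply/ratiosP; exists (f \* g); split => //; last exact: fourierM_ge0.
  (* The product is nonzero because both factors are positive at 0. *)
  by apply: S12 => //; exists 0; rewrite /= gt_eqF // mulr_gt0.
have -> : #|G|%:R * (f 0 / \sum_x f x) * (g 0 / \sum_x g x) =
    f 0 * g 0 * (#|G|%:R / ((\sum_x f x) * (\sum_x g x))).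
  by field; rewrite !gt_eqF.
rewrite ler_pM2l ?mulr_gt0 // ler_pdivlMr ?mulr_gt0 //.
by rewrite mulrC ler_pdivrMr.
Qed.

(** * Attainment of the minima *)

(** A common form for the four classes, so that one compactness argument serves them all. *)
Definition cone_class (P : G -> set R) : set (G -> R) :=
  [set f | nonzero f /\ forall x, P x (f x)].

(** Splitting into real and imaginary parts turns nonnegativity of the transform into closed real
    linear conditions on [f]. *)
Lemma fourierE f gamma : fourier f gamma =
  (\sum_x complex.Re (gamma x) * f x) +i* (\sum_x complex.Im (gamma x) * f x).
Proof.
rewrite /fourier; elim/big_rec3: _ => // x a b c _ ->.
by case: (gamma x) => u v /=; simpc.
Qed.

Lemma fourierZ t f gamma :
  fourier (fun x => t * f x) gamma = t%:C * fourier f gamma.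
Proof.
by rewrite /fourier mulr_sumr; apply: eq_bigr => x _; rewrite rmorphM mulrCA.
Qed.

Lemma continuous_mull (T : topologicalType) (a : R) (g : T -> R) :
  continuous g -> continuous (fun t => a * g t).
Proof.
by move=> cg t; exact: (@continuousM R T (fun=> a) g t (cvg_cst _) (cg t)).
Qed.

Lemma continuous_eval (x : G) : continuous (fun f : {ptws G -> R} => f x).
Proof. exact: (@proj_continuous G (fun=> R : topologicalType) x). Qed.

Lemma continuous_lincomb (c : G -> R) :
  continuous (fun f : {ptws G -> R} => \sum_x c x * f x).
Proof.
apply: continuous_big => [|x _]; first exact: add_continuous.
exact: (@continuous_mull {ptws G -> R} (c x) _ (@continuous_eval x)).
Qed.

Lemma compact_box (a b : R) :
  compact [set f : {ptws G -> R} | forall x, f x \in `[a, b]].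
Proof.
apply: (@tychonoff G (fun=> R : topologicalType) (fun=> `[a, b]%classic)) => x.
exact: segment_compact.
Qed.

Lemma closed_preimage (T U : topologicalType) (f : T -> U) (D : set U) :
  continuous f -> closed D -> closed (f @^-1` D).
Proof. by move=> cf; apply: preimage_closed => x _; exact: cf. Qed.

(* Normalising [\sum_x f x = 1] turns the ratio into [f 0]; the competitors with
   [f 0 <= 1] form a closed subset of the cube [-1, 1]^G. *)
Lemma ratios_min (P : G -> set R) :
  (forall x, closed (P x)) -> (forall x t r, 0 < t -> P x r -> P x (t * r)) ->
  (forall x, P x (x == 0)%:R) ->
  exists r, (ratios (cone_class P) `&` lbound (ratios (cone_class P))) r.
Proof.
move=> Pcl PZ P1.
(* The sum of [f] and the value [f 0] are written with explicit coefficients so that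
   [continuous_lincomb] applies to them too. *)
pose K : set {ptws G -> R} :=
  [set f : {ptws G -> R} | \sum_x 1 * f x = 1] `&`
  [set f : {ptws G -> R} | \sum_x (x == 0)%:R * f x <= 1] `&`
  \bigcap_(x in [set: G]) [set f : {ptws G -> R} | P x (f x)] `&`
  \bigcap_(gamma in [set: character R G])
     ([set f : {ptws G -> R} | \sum_x complex.Im (gamma x) * f x = 0] `&`
      [set f : {ptws G -> R} | 0 <= \sum_x complex.Re (gamma x) * f x]).
have delta0 f : \sum_x (x == 0)%:R * f x = f 0.
  rewrite (bigD1 0) //= big1 => [|x /negbTE ->]; last by rewrite mul0r.
  by rewrite eqxx mul1r addr0.
have sum1 f : \sum_x 1 * f x = \sum_x f x by apply: eq_bigr => x _; rewrite mul1r.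
have KP f : K f <-> [/\ \sum_x f x = 1, f 0 <= 1, forall x, P x (f x)
                     & forall gamma, 0 <= fourier f gamma].
  rewrite /K /= sum1 delta0; split.
    move=> [[[fs f1] Pf] ff]; split => // [x|gamma]; first exact: Pf.
    have [fI fR] := ff gamma I.
    by rewrite fourierE lecE /= fI eqxx.
  move=> [fs f1 Pf ff]; split=> [|gamma _]; first by split=> // x _; exact: Pf.
  by have := ff gamma; rewrite fourierE lecE /= => /andP[/eqP].
have Kcl : closed K.
  apply: closedI; last first.
    apply: closed_bigI => gamma _; apply: closedI.
      exact: (closed_preimage (@continuous_lincomb _) (@closed_eq _ _)).
    exact: (closed_preimage (@continuous_lincomb _) (@closed_ge _ _)).
  apply: closedI; last first.
    apply: closed_bigI => x _.
    exact: (closed_preimage (@continuous_eval x) (Pcl x)).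
  apply: closedI.
    exact: (closed_preimage (@continuous_lincomb _) (@closed_eq _ _)).
  exact: (closed_preimage (@continuous_lincomb _) (@closed_le _ _)).
have Kco : compact K.
  apply: (subclosed_compact Kcl (@compact_box (- 1) 1)).
  move=> f /KP[_ f1 _ ff] x /=; rewrite in_itv /= -ler_norml.
  exact: le_trans (fourier_ge0_norm_le ff x) f1.
(* The indicator of 0 has transform constantly 1. *)
have K0 : K !=set0.
  exists (fun x => (x == 0)%:R); apply/KP; split => //.
  - by rewrite -[LHS]sum1; under eq_bigr do rewrite mulrC; rewrite delta0.
  - by rewrite eqxx.
  - move=> gamma; rewrite /fourier (bigD1 0) //= big1 => [|x /negbTE ->].
      by rewrite eqxx char0 mulr1 addr0.
    by rewrite mulr0.
have [c /set_mem/KP[cs c1 Pc cc] cmin] := compact_EVT_min K0 Kco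
  (continuous_subspaceT (@continuous_eval 0)).
exists (c 0); split.
  apply/ratiosP; exists c; rewrite cs divr1; split => //; split => //.
  apply/not_existsP => c0; have := oner_neq0 R; rewrite -cs big1 ?eqxx // => x _.
  by apply/eqP/negPn/negP/c0.
move=> r /ratiosP[f [[fnz Pf] ff fs ->]].
(* A ratio above 1 already exceeds [c 0]; any other competitor is rescaled into [K]. *)
have [f1|/ltW f1] := leP (f 0 / \sum_x f x) 1; last exact: le_trans f1.
have := cmin (fun x => (\sum_x f x)^-1 * f x); rewrite mulrC; apply.
apply/mem_set/KP; split=> [||x|gamma].
- by rewrite -mulr_sumr mulVf // gt_eqF.
- by rewrite mulrC.
- by apply: PZ; rewrite ?invr_gt0.
- by rewrite fourierZ mulr_ge0 // ler0c invr_ge0 ltW.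
Qed.

(** As the minima for [S1] and [S2] are attained, they are themselves ratios, and [ratiosM] yields a
    ratio for [S] below the bound. *)
Lemma min_ofM (S1 S2 S : set (G -> R)) :
  S1 `<=` @nonzero R G -> S2 `<=` @nonzero R G ->
  (forall f g, S1 f -> S2 g -> nonzero (f \* g) -> S (f \* g)) ->
  (exists r, (ratios S1 `&` lbound (ratios S1)) r) ->
  (exists r, (ratios S2 `&` lbound (ratios S2)) r) ->
  (exists r, (ratios S `&` lbound (ratios S)) r) ->
  min_of (ratios S) <= #|G|%:R * min_of (ratios S1) * min_of (ratios S2).
Proof.
move=> nz1 nz2 S12 /(xgetPex 0)[m1 _] /(xgetPex 0)[m2 _] /(xgetPex 0)[_ lb].
by have [r Sr] := ratiosM nz1 nz2 S12 m1 m2; apply: le_trans; exact: lb.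
Qed.

(** * The four classes as closed cones *)

Lemma closed_implies (T : topologicalType) (b : bool) (D : set T) :
  closed D -> closed [set x | b -> D x].
Proof.
move=> clD; rewrite (_ : [set _ | _] = if b then D else setT).
  by case: b => //; exact: closedT.
by apply/seteqP; case: b; split=> x //=; exact.
Qed.

Lemma notin_neq0 A x : 0 \in A -> x \notin A -> (x == 0) = false.
Proof. by move=> A0; apply: contraNF => /eqP ->. Qed.

Lemma class_S_min A : 0 \in A ->
  exists r, (ratios (@class_S R G A) `&` lbound (ratios (class_S A))) r.
Proof.
move=> A0.
apply: (@ratios_min (fun x => [set r : R | x \notin A -> r = 0])).
- by move=> x; exact: (closed_implies (@closed_eq R 0)).
- by move=> x t r _ rP xA; rewrite rP ?mulr0.
- by move=> x xA; rewrite (notin_neq0 A0 xA).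
Qed.

Lemma class_Sminus_min A : 0 \in A ->
  exists r, (ratios (@class_Sminus R G A) `&` lbound (ratios (class_Sminus A))) r.
Proof.
move=> A0.
apply: (@ratios_min (fun x => [set r : R | x \notin A -> r <= 0])).
- by move=> x; exact: (closed_implies (@closed_le R 0)).
- by move=> x t r t0 rP xA; rewrite pmulr_rle0 ?rP.
- by move=> x xA; rewrite (notin_neq0 A0 xA).
Qed.

Lemma class_Splus_min A : 0 \in A ->
  exists r, (ratios (@class_Splus R G A) `&` lbound (ratios (class_Splus A))) r.
Proof.
move=> A0.
rewrite (_ : class_Splus A = cone_class (fun x =>
  [set r : R | x \notin A -> r = 0] `&` [set r : R | x \in A -> 0 <= r])).
  apply: ratios_min => [x|x t r t0 [rN rA]|x].
  - exact: (closedI (closed_implies (@closed_eq R 0)) (closed_implies (@closed_ge R 0))).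
  - by split=> xA; [rewrite rN ?mulr0|rewrite pmulr_rge0 ?rA].
  - by split=> // xA; rewrite (notin_neq0 A0 xA).
apply/seteqP; split=> f /= => [[nz f0 fA]|[nz fP]].
  by split=> // x; split=> /=; auto.
by split=> // x; have [] := fP x.
Qed.

Lemma class_Spm_min A : 0 \in A ->
  exists r, (ratios (@class_Spm R G A) `&` lbound (ratios (class_Spm A))) r.
Proof.
move=> A0.
rewrite (_ : class_Spm A = cone_class (fun x =>
  [set r : R | x \notin A -> r <= 0] `&` [set r : R | x \in A -> 0 <= r])).
  apply: ratios_min => [x|x t r t0 [rN rA]|x].
  - exact: (closedI (closed_implies (@closed_le R 0)) (closed_implies (@closed_ge R 0))).
  - by split=> xA; [rewrite pmulr_rle0 ?rN|rewrite pmulr_rge0 ?rA].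
  - by split=> // xA; rewrite (notin_neq0 A0 xA).
apply/seteqP; split=> f /= => [[nz f0 fA]|[nz fP]].
  by split=> // x; split=> /=; auto.
by split=> // x; have [] := fP x.
Qed.

Lemma class_Splus_ge0 A f x : class_Splus A f -> 0 <= f x.
Proof.
by move=> [_ f0 fA]; have [/fA//|/f0 ->] := boolP (x \in A).
Qed.

End Characters.

Theorem theorem6p3 (R : realType) (G : finZmodType) (q : nat) (A1 A2 : {set G}) :
  #|G| = q -> standard A1 -> standard A2 ->
  [/\ lambda R (A1 :&: A2) <= q%:R * lambda R A1 * lambda R A2,
      lambda_plus R (A1 :&: A2) <= q%:R * lambda_plus R A1 * lambda_plus R A2,
      lambda_minus R (A1 :&: A2) <= q%:R * lambda_minus R A1 * lambda_plus R A2
    & lambda_pm R (A1 :&: A2) <= q%:R * lambda_pm R A1 * lambda_plus R A2].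
Proof.
move=> <- [_ A10] [_ A20].
have A0 : 0 \in A1 :&: A2 by rewrite inE A10.
have notI x : x \notin A1 :&: A2 -> x \notin A1 \/ x \notin A2.
  by rewrite inE negb_and => /orP.
have inI x : x \in A1 :&: A2 -> x \in A1 /\ x \in A2.
  by rewrite inE => /andP.
have nzS A : class_S A `<=` @nonzero R G by move=> f [].
have nzSm A : class_Sminus A `<=` @nonzero R G by move=> f [].
have nzSp A : class_Splus A `<=` @nonzero R G by move=> f [].
have nzSpm A : class_Spm A `<=` @nonzero R G by move=> f [].
split; apply: min_ofM => //; try exact: class_S_min; try exact: class_Splus_min;
  try exact: class_Sminus_min; try exact: class_Spm_min.
- move=> f g [_ f0] [_ g0] nz; split=> // x /notI[/f0|/g0] /= ->.
    by rewrite mul0r.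
  by rewrite mulr0.
- move=> f g [_ f0 fA] [_ g0 gA] nz; split=> // x.
    by move=> /notI[/f0|/g0] /= ->; rewrite ?mul0r ?mulr0.
  by move=> /inI[/fA ? /gA ?]; exact: mulr_ge0.
(* Outside [A1] a nonpositive value meets a nonnegative one. Outside [A2] the sign of [f] may be
   arbitrary, but [g] vanishes there. *)
- move=> f g [_ f0] gS nz; split=> // x /notI[/f0 fx|] /=.
    by rewrite mulr_le0_ge0 // (class_Splus_ge0 _ gS).
  by case: gS => [_ g0 _ /g0 ->]; rewrite mulr0.
- move=> f g [_ f0 fA] gS nz; split=> // x; last first.
    by move=> /inI[/fA ? _]; rewrite /= mulr_ge0 // (class_Splus_ge0 _ gS).
  move=> /notI[/f0 fx|] /=.
    by rewrite mulr_le0_ge0 // (class_Splus_ge0 _ gS).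
  by case: gS => [_ g0 _ /g0 ->]; rewrite mulr0.
Qed.
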